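(* Let $\{\alpha_k\}_{k\ge1}$ be a sequence of positive step sizes, let $N\geq 1$ and $R\ge 0$. Let $F:\mathbb{E}\to\mathbb{R}\cup\{\infty\}$ be a proper, closed and convex function with a minimizer $x_*$, put $F_*=F(x_* )$, and let $x_0\in\mathbb{E}$ satisfy $\|x_0-x_*\|_{\mathbb{E}}\leq R$. Then the sequence $\{x_k\}$ generated by the proximal point algorithm with step sizes $\{\alpha_k\}$, i.e. $$x_k=\operatorname*{argmin}_{x\in\mathbb{E}}\Big\{\alpha_kF(x)+\tfrac12\|x_{k-1}-x\|_{\mathbb{E}}^2\Big\},\qquad k\geq 1,$$ satisfies $$F(x_N)-F_*\leq\frac{R^2}{4\sum_{k=1}^N\alpha_k}.$$ Moreover this bound cannot be improved, even in dimension one: for every $N\ge 1$, every $R\ge 0$, all positive step sizes $\{\alpha_k\}$ and every $\mathbb{E}$ with $\dim\mathbb{E}=1$, the supremum of $F(x_N)-F_*$ over all proper, closed and convex functions $F:\mathbb{E}\to\mathbb{R}\cup\{\infty\}$ having a minimizer, all minimizers $x_*$ of $F$ (with $F_*=F(x_* )$), and all $x_0\in\mathbb{E}$ with $\|x_0-x_*\|_{\mathbb{E}}\leq R$, where $x_N$ is the $N$-th iterate of the proximal point algorithm with step sizes $\{\alpha_k\}$ applied to $F$ and started at $x_0$, equals $\frac{R^2}{4\sum_{k=1}^N\alpha_k}$.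
   Context: $\mathbb{E}$ is a finite-dimensional real vector space with dual $\mathbb{E}^*$, $\langle\cdot,\cdot\rangle:\mathbb{E}^*\times\mathbb{E}\to\mathbb{R}$ is a dual pairing (nondegenerate bilinear map), $B:\mathbb{E}\to\mathbb{E}^*$ is a self-adjoint positive definite linear operator, and $\|x\|_{\mathbb{E}}^2=\langle Bx,x\rangle$ for $x\in\mathbb{E}$. *)

(* Defs.v *)
From HB Require Import structures.
From mathcomp Require Import all_boot all_order all_algebra.
From mathcomp Require Import boolp classical_sets reals ereal.

Set Implicit Arguments.
Unset Strict Implicit.
Unset Printing Implicit Defensive.

Import Order.TTheory GRing.Theory Num.Theory.

Local Open Scope classical_set_scope.
Local Open Scope ring_scope.

Section DualPairing.
Context {K : realType} {E : vectType K}.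

Definition dual : vectType K := 'Hom(E, K^o).

(* [sesquilinear.nondegenerate] only covers forms on a single space. *)
Definition nondegenerate_pairing
    (pair : {bilinear dual -> E -> K | *%R & *%R}) : Prop :=
  (forall u : dual, (forall x : E, pair u x = 0) -> u = 0) /\
  (forall x : E, (forall u : dual, pair u x = 0) -> x = 0).

Definition self_adjoint (pair : {bilinear dual -> E -> K | *%R & *%R})
    (B : {linear E -> dual}) : Prop :=
  forall x y : E, pair (B x) y = pair (B y) x.

Definition positive_definite (pair : {bilinear dual -> E -> K | *%R & *%R})
    (B : {linear E -> dual}) : Prop :=
  forall x : E, x != 0 -> 0 < pair (B x) x.

Definition normE (pair : {bilinear dual -> E -> K | *%R & *%R})
    (B : {linear E -> dual}) (x : E) : K :=
  Num.sqrt (pair (B x) x).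

End DualPairing.

Arguments dual {K} E.

Section ExtendedFunctions.
Context {K : realType} {E : vectType K}.
Implicit Types F : E -> \bar K.

(* The first conjunct makes [F] a function into K together with +oo. *)
Definition proper_function F : Prop :=
  (forall x, F x != -oo%E) /\ (exists x, (F x < +oo)%E).

Definition epigraph F : set (E * K) := [set p | (F p.1 <= p.2%:E)%E].

(* Every point of E * K adherent to the epigraph lies in it. The topology of E
   is the one given by [normE]; as E is finite-dimensional, any norm would
   define the same closed sets. *)
Definition closed_function (pair : {bilinear dual E -> E -> K | *%R & *%R})
    (B : {linear E -> dual E}) F : Prop :=
  forall p : E * K,
    (forall e : K, 0 < e -> exists2 q, epigraph F q &
      normE pair B (q.1 - p.1) < e /\ `|q.2 - p.2| < e) ->
    epigraph F p.

(* In [\bar K], 0 * +oo = 0, so the cases t = 0 and t = 1 are trivial. *)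
Definition convex_efunction F : Prop :=
  forall (x y : E) (t : K), 0 <= t <= 1 ->
    (F (t *: x + (1 - t) *: y)%R <= t%:E * F x + (1 - t)%:E * F y)%E.

Definition argmin F : set E := [set x | forall y, (F x <= F y)%E].

(* The starting point is [x 0]. *)
Definition proximal_sequence (pair : {bilinear dual E -> E -> K | *%R & *%R})
    (B : {linear E -> dual E}) (alpha : nat -> K) F (x : nat -> E) : Prop :=
  forall k : nat, (1 <= k)%N ->
    argmin (fun z => (alpha k)%:E * F z
                     + (2^-1 * normE pair B (x k.-1 - z) ^+ 2)%:E)%E (x k).

End ExtendedFunctions.

(* Main.v *)
(* Put T_i = alpha_1 + ... + alpha_i and S = T_N. The iterates satisfy
   x_(i-1) - x_i = alpha_i g_i with g_i a subgradient of F at x_i. Adding the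
   subgradient inequalities of g_i at x_* and at x_(i-1), with suitable weights,
   to a multiple of |g_i - (x_i - x_* ) / (2S - T_i)|^2 shows that
     T_i / (2S - T_i) (F(x_i) - F_* ) + (S - T_i) / (2S - T_i)^2 |x_i - x_*|^2
   is nonincreasing in i; it is |x_0 - x_*|^2 / (4S) at i = 0 and F(x_N) - F_*
   at i = N. The square vanishes for F = R / (2S) |x|, which attains the
   bound. *)

Require Import Defs.
From HB Require Import structures.
From mathcomp Require Import all_boot all_order all_algebra.
From mathcomp Require Import boolp classical_sets reals ereal.
From mathcomp Require Import ring lra.

Set Implicit Arguments.
Unset Strict Implicit.
Unset Printing Implicit Defensive.

Import Order.TTheory GRing.Theory Num.Theory.

Local Open Scope classical_set_scope.
Local Open Scope ring_scope.

(** * Two inequalities in an ordered field *)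

Lemma ge0_of_small_perturbation (K : realFieldType) (A c : K) : 0 <= c ->
  (forall t, 0 < t <= 1 -> 0 <= A + t * c) -> 0 <= A.
Proof.
move=> c0 H; rewrite leNgt; apply/negP => A0.
have d0 : 0 < 2 * c - A by lra.
(* This value of [t] stands in for the limit [t -> 0]: when [A < 0] it makes [A + t * c] equal to
   [A * (c - A) / (2 * c - A)], which is negative. *)
have t0 : 0 < - A / (2 * c - A) by rewrite divr_gt0 // oppr_gt0.
have /H : 0 < - A / (2 * c - A) <= 1 by rewrite t0 ler_pdivrMr // mul1r; lra.
have -> : A + - A / (2 * c - A) * c = A * (c - A) / (2 * c - A).
  by field; rewrite gt_eqF.
by rewrite ler_pdivlMr // mul0r; nra.
Qed.

(* The difference of the two sides is a combination of the last two hypotheses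
   and of a nonnegative multiple of the square in the third one. *)
Lemma lyapunov_step (K : realFieldType) (S u a f f' X Y Z : K) :
  0 < a -> 0 < S -> S <= u -> u + a <= 2 * S ->
  0 <= Z - 2 * Y / u + X / u ^+ 2 ->
  f <= Y ->
  (2 * S / (u + a) - 1) * (f - f') <= (2 * S / (u + a) - 1) * (- a * Z) ->
  (2 * S / u - 1) * f + (u - S) / u ^+ 2 * X <=
  (2 * S / (u + a) - 1) * f' +
  (u + a - S) / (u + a) ^+ 2 * (X + 2 * a * Y + a ^+ 2 * Z).
Proof.
move=> a0 S0 Su ua Q fY D.
have u0 : 0 < u by lra.
have v0 : 0 < u + a by lra.
(* This weight of [f <= Y] is [2 * S / u - 2 * S / (u + a)], the change in the coefficient of the
   function value. *)
have c0 : 0 <= 2 * S * a / (u * (u + a)).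
  by rewrite divr_ge0 ?mulr_ge0 ?ltW.
(* The weight of the square. With [v = u + a], [S * (u + v) - u * v] is
   [S ^+ 2 - (u - S) * (v - S)], and both factors lie between 0 and [S]. *)
have P0 : 0 <= a * (S * (u + (u + a)) - u * (u + a)) / (u + a) ^+ 2.
  rewrite divr_ge0 ?exprn_ge0 ?mulr_ge0 ?(ltW a0) ?(ltW v0) //.
  by nra.
have H1 := ler_wpM2l c0 fY.
have H2 := mulr_ge0 P0 Q.
rewrite -subr_ge0.
apply: le_trans (addr_ge0 (addr_ge0 (_ : 0 <= _ - _) (_ : 0 <= _ - _)) H2) _.
- by rewrite subr_ge0; exact: H1.
- by rewrite subr_ge0; exact: D.
rewrite le_eqVlt; apply/orP; left; apply/eqP; field.
by rewrite !gt_eqF.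
Qed.

(** * The inner product [pair (B x) y] and its norm *)

Section InnerProduct.
Context {K : realType} {E : vectType K}.
Context (pair : {bilinear dual E -> E -> K | *%R & *%R}).
Context (B : {linear E -> dual E}).
Context (hBsa : self_adjoint pair B) (hBpd : positive_definite pair B).

Local Notation inner x y := (pair (B x) y).
Local Notation norm := (normE pair B).

Lemma innerDr x y z : inner x (y + z) = inner x y + inner x z.
Proof. by rewrite linearDr. Qed.

Lemma innerZr x a y : inner x (a *: y) = a * inner x y.
Proof. by rewrite linearZr. Qed.

Lemma innerNr x y : inner x (- y) = - inner x y.
Proof. by rewrite linearNr. Qed.

Lemma innerDl x y z : inner (x + y) z = inner x z + inner y z.
Proof. by rewrite !(hBsa _ z) innerDr. Qed.

Lemma innerZl x a y : inner (a *: x) y = a * inner x y.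
Proof. by rewrite !(hBsa _ y) innerZr. Qed.

Lemma innerNl x y : inner (- x) y = - inner x y.
Proof. by rewrite !(hBsa _ y) innerNr. Qed.

Definition innerE := (innerDr, innerDl, innerNr, innerNl, innerZr, innerZl).

Lemma inner_ge0 x : 0 <= inner x x.
Proof.
have [->|/hBpd/ltW//] := eqVneq x 0.
by rewrite -(scale0r (0 : E)) innerZl mul0r.
Qed.

Lemma sqr_norm x : norm x ^+ 2 = inner x x.
Proof. by rewrite sqr_sqrtr ?inner_ge0. Qed.

Lemma norm_ge0 x : 0 <= norm x.
Proof. exact: sqrtr_ge0. Qed.

Lemma norm_gt0 x : x != 0 -> 0 < norm x.
Proof. by move=> /hBpd; rewrite sqrtr_gt0. Qed.

Lemma normZ a x : norm (a *: x) = `|a| * norm x.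
Proof.
by rewrite /normE !innerE mulrA -expr2 sqrtrM ?sqr_ge0 // sqrtr_sqr.
Qed.

Lemma norm0 : norm 0 = 0.
Proof. by rewrite -(scale0r (0 : E)) normZ normr0 mul0r. Qed.

(** Cauchy-Schwarz: for nonzero vectors, the squared norm of [norm y *: x - norm x *: y] is
    [2 * norm x * norm y] times the gap between the two sides. *)
Lemma inner_le_norm x y : inner x y <= norm x * norm y.
Proof.
have [->|x0] := eqVneq x 0.
  by rewrite norm0 mul0r -(scale0r (0 : E)) innerZl mul0r.
have [->|y0] := eqVneq y 0.
  by rewrite norm0 mulr0 -(scale0r (0 : E)) innerZr mul0r.
have nx := norm_gt0 x0; have ny := norm_gt0 y0.
have := inner_ge0 (norm y *: x - norm x *: y).
rewrite !innerE (hBsa y x) -!sqr_norm.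
set p := norm x in nx *; set q := norm y in ny *; set c := inner x y => H.
have pq : 0 < p * q by rewrite mulr_gt0.
rewrite -(ler_pM2l pq); nra.
Qed.

Lemma norm_triangle x y : norm (x + y) <= norm x + norm y.
Proof.
rewrite -(@ler_pXn2r _ 2) // ?nnegrE ?addr_ge0 ?norm_ge0 //.
rewrite sqr_norm !innerE (hBsa y x) sqrrD -!sqr_norm.
by have := inner_le_norm x y; lra.
Qed.

(** * Subgradients at the iterates and the convergence rate *)

Lemma proximal_subgradient (F : E -> \bar K) (a : K) (p q : E) :
  proper_function F -> convex_efunction F -> 0 < a ->
  argmin (fun z => a%:E * F z + (2^-1 * norm (p - z) ^+ 2)%:E)%E q ->
  forall y, (F q + (a^-1 * inner (p - q) (y - q))%:E <= F y)%E.
Proof.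
move=> [Fnoo _] Fcvx a0 qmin y.
have := Fnoo y; case Fy : (F y) => [r| |] // _; last by rewrite leey.
have := qmin y; rewrite Fy.
have := Fnoo q; case Fq : (F q) => [s| |] // _; last first.
  by rewrite gt0_muley ?lte_fin // addye // leye_eq.
move=> _.
rewrite -EFinD lee_fin.
suff : 0 <= a * (r - s) - inner (p - q) (y - q).
  move=> H; rewrite -(ler_pM2l a0) mulrDr mulrA divff ?gt_eqF // mul1r; lra.
(* Minimality of [q] against [t *: y + (1 - t) *: q], convexity and division by [t] give the claim
   up to an error of [t] times half the squared norm of [y - q]. *)
apply: (@ge0_of_small_perturbation _ _ (2^-1 * inner (y - q) (y - q))).
  by rewrite mulr_ge0 ?inner_ge0.
move=> t /andP[t0 t1].
have := Fcvx y q t; rewrite (ltW t0) t1 => /(_ isT).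
have := qmin (t *: y + (1 - t) *: q); rewrite Fy Fq /=.
have := Fnoo (t *: y + (1 - t) *: q).
case: (F _) => [m| |] // _.
rewrite -!EFinM -!EFinD !lee_fin => H1 H2.
have : p - (t *: y + (1 - t) *: q) = (p - q) - t *: (y - q).
  rewrite scalerBl scale1r scalerBr !opprD !opprK -!addrA; congr (_ + _).
  by rewrite addrCA.
move=> Ez; move: H1; rewrite Ez !sqr_norm.
rewrite !(innerDl (p - q)) !(innerDr _ (p - q)) !(innerNl (t *: _)).
rewrite !(innerNr _ (t *: _)) !innerZl !innerZr (hBsa (y - q) (p - q)).
move: H2; set c := inner (p - q) (p - q); set be := inner (p - q) (y - q).
set ga := inner (y - q) (y - q) => H2 H1.
rewrite -(pmulr_rge0 _ t0); have := ler_wpM2l (ltW a0) H2; nra.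
Qed.

(** Here [f] and [x] stand for the gaps F(x_k) - F_* and the differences x_k - x_*, and [g] for the
    subgradients. The value [f 0] is left unconstrained because F(x_0) may be infinite. *)
Lemma proximal_rate (alpha : nat -> K) (N : nat) (f : nat -> K) (x g : nat -> E) :
  (forall k, (1 <= k)%N -> 0 < alpha k) -> (1 <= N)%N ->
  (forall k, x k = x k.+1 + alpha k.+1 *: g k.+1) ->
  (forall k, f k.+1 <= inner (g k.+1) (x k.+1)) ->
  (forall k, (1 <= k)%N -> f k.+1 - f k <= - alpha k.+1 * inner (g k.+1) (g k.+1)) ->
  f N <= inner (x 0) (x 0) / (4 * \sum_(1 <= k < N.+1) alpha k).
Proof.
move=> alpha0 N1 xg fg df.
pose T i := \sum_(1 <= k < i.+1) alpha k.
have T0 : T 0 = 0 by rewrite /T big_nil.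
have TS i : T i.+1 = T i + alpha i.+1 by rewrite /T big_nat_recr.
have Tge i : 0 <= T i.
  by elim: i => [|i IH]; rewrite ?T0 // TS addr_ge0 // ltW // alpha0.
have Tmono i j : (i <= j)%N -> T i <= T j.
  elim: j => [|j IH]; first by rewrite leqn0 => /eqP->.
  rewrite leq_eqVlt => /orP[/eqP->//|/IH /le_trans]; apply.
  by rewrite TS lerDl ltW // alpha0.
have S0 : 0 < T N.
  by apply: lt_le_trans (Tmono _ _ N1); rewrite TS T0 add0r alpha0.
rewrite -/(T N); set S := T N in S0 *.
have main i : (i <= N)%N ->
  (2 * S / (2 * S - T i) - 1) * f i +
  (2 * S - T i - S) / (2 * S - T i) ^+ 2 * inner (x i) (x i) <=
  inner (x 0) (x 0) / (4 * S).
  elim: i => [_|i IH iN].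
    rewrite T0 le_eqVlt; apply/orP; left; apply/eqP; field; by rewrite gt_eqF.
  apply: le_trans (IH (ltnW iN)).
  have TN := Tmono _ _ iN; rewrite -/S in TN.
  have a0 := alpha0 i.+1 isT.
  have -> : 2 * S - T i = 2 * S - T i.+1 + alpha i.+1 by rewrite TS; ring.
  have -> : inner (x i) (x i) = inner (x i.+1) (x i.+1)
      + 2 * alpha i.+1 * inner (g i.+1) (x i.+1)
      + alpha i.+1 ^+ 2 * inner (g i.+1) (g i.+1).
    by rewrite xg !innerE (hBsa (x i.+1)); ring.
  have u0 : 0 < 2 * S - T i.+1 by lra.
  have ua : 2 * S - T i.+1 + alpha i.+1 <= 2 * S by rewrite TS; have := Tge i; lra.
  (* Here [u = 2 * S - T i.+1], [u + a = 2 * S - T i], and [X], [Y], [Z] are the inner products of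
     [x i.+1] and [g i.+1]; the square is the squared norm of [g i.+1 - u^-1 *: x i.+1]. *)
  apply: lyapunov_step => //; first by lra.
    have := inner_ge0 (g i.+1 - (2 * S - T i.+1)^-1 *: x i.+1).
    rewrite !innerE (hBsa (x i.+1)); move=> /le_trans; apply.
    by rewrite le_eqVlt; apply/orP; left; apply/eqP; field; rewrite gt_eqF.
  (* For [i = 0] the weight [2 * S / (u + a) - 1] vanishes, which removes [f 0] from the
     inequality. *)
  case: i {IH} iN TN a0 u0 ua => [|i] iN TN a0 u0 ua.
    have -> : 2 * S - T 1 + alpha 1 = 2 * S by rewrite TS T0; ring.
    by rewrite divff ?subrr ?mul0r // gt_eqF // mulr_gt0.
  apply: ler_wpM2l; last exact: df.
  by rewrite subr_ge0 ler_pdivlMr ?mul1r // addr_gt0.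
(* At [i = N], [2 * S - T N = S]: the coefficient of [f N] is 1 and the norm term vanishes. *)
have := main N (leqnn N); rewrite -/S.
have -> : 2 * S - S = S by ring.
by rewrite subrr !mul0r addr0 mulfK ?gt_eqF //; lra.
Qed.

Lemma proximal_upper_bound (alpha : nat -> K) (N : nat) (R : K)
    (F : E -> \bar K) (xstar : E) (x : nat -> E) :
  (forall k, (1 <= k)%N -> 0 < alpha k) -> (1 <= N)%N ->
  proper_function F -> convex_efunction F -> argmin F xstar ->
  norm (x 0%N - xstar) <= R -> proximal_sequence pair B alpha F x ->
  (F (x N) - F xstar <= (R ^+ 2 / (4 * \sum_(1 <= k < N.+1) alpha k))%:E)%E.
Proof.
move=> alpha0 N1 Fproper Fcvx Fmin x0R xprox.
have [Fnoo [y0 Fy0]] := Fproper.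
have [Fs Fsf] : exists r, F xstar = r%:E.
  have := le_lt_trans (Fmin y0) Fy0; have := Fnoo xstar.
  by case: (F xstar) => // r; exists r.
have sub k y := proximal_subgradient Fproper Fcvx (alpha0 k.+1 isT) (xprox k.+1 isT) y.
(* The subgradient inequality at [xstar] excludes [+oo] from the first iterate on. Only [x 0] may
   have an infinite value, which [fine] sends to 0. *)
have Ffin k : F (x k.+1) = (fine (F (x k.+1)))%:E.
  have := sub k xstar; have := Fnoo (x k.+1); rewrite Fsf.
  by case: (F _) => // r; rewrite addye // leye_eq.
pose g k := (alpha k)^-1 *: (x k.-1 - x k).
have bound : fine (F (x N)) - Fs <=
    inner (x 0 - xstar) (x 0 - xstar) / (4 * \sum_(1 <= k < N.+1) alpha k).
  apply: (@proximal_rate alpha N (fun k => fine (F (x k)) - Fs)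
    (fun k => x k - xstar) g) => // [k|k|[//|k] _].
  - rewrite /g scalerA divff ?gt_eqF ?alpha0 // scale1r /=.
    by rewrite [RHS]addrC addrA subrK.
  - have := sub k xstar; rewrite Fsf Ffin -EFinD lee_fin /g innerZl /=.
    rewrite -(opprB _ xstar) innerNr; lra.
  - have := sub k.+1 (x k.+1); rewrite (Ffin k) (Ffin k.+1) -EFinD lee_fin /=.
    have -> : x k.+1 - x k.+2 = alpha k.+2 *: g k.+2.
      by rewrite /g scalerA divff ?gt_eqF ?alpha0 // scale1r.
    rewrite !innerE mulKf ?gt_eqF ?alpha0 //; lra.
case: N N1 bound => // n _ bound.
rewrite Ffin Fsf -EFinB lee_fin (le_trans bound) //.
rewrite ler_wpM2r ?invr_ge0 ?mulr_ge0 //.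
  by rewrite big_nat sumr_ge0 // => k /andP[k1 _]; exact/ltW/alpha0.
by rewrite -sqr_norm ler_pXn2r ?nnegrE ?norm_ge0 // (le_trans (norm_ge0 _) x0R).
Qed.

(** * The scaled norm as extremal function *)

Lemma scaled_norm_closed (c : K) : 0 <= c ->
  closed_function pair B (fun z => (c * norm z)%:E).
Proof.
move=> c0 [p t] H; rewrite /epigraph /= lee_fin; apply/ler_addgt0Pr => e e0.
(* The radius [d = e / (c + 1)] satisfies [c * d + d = e], also when [c = 0]. *)
have d0 : 0 < e / (c + 1) by rewrite divr_gt0 // ltr_wpDl.
have [[q s]] := H _ d0; rewrite /epigraph /= lee_fin => qs [qp st].
have pq : norm p <= norm q + norm (q - p).
  rewrite -[norm (q - p)]mul1r -(normrN1 K) -normZ scaleN1r opprB.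
  by rewrite (le_trans _ (norm_triangle _ _)) // addrC subrK.
have := ler_wpM2l c0 pq; have := ler_wpM2l c0 (ltW qp).
have := ler_norm (s - t).
have : c * (e / (c + 1)) + e / (c + 1) = e by field; rewrite gt_eqF // ltr_wpDl.
lra.
Qed.

Lemma scaled_norm_convex (c : K) : 0 <= c ->
  convex_efunction (fun z : E => (c * norm z)%:E).
Proof.
move=> c0 x y t /andP[t0 t1]; rewrite -!EFinM -EFinD lee_fin.
apply: (le_trans (ler_wpM2l c0 (norm_triangle _ _))).
by rewrite !normZ !ger0_norm ?subr_ge0 //; lra.
Qed.

(** By Cauchy-Schwarz the norm of [r *: e - z] is at least the distance from [r] to [norm z], so the
    problem reduces to the half-line, where the minimizer is the soft threshold of [r]. *)
Lemma proximal_scaled_norm (a c r : K) (e : E) :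
  norm e = 1 -> 0 <= c -> 0 < a -> 0 <= r ->
  argmin (fun z => a%:E * (c * norm z)%:E
                   + (2^-1 * norm (r *: e - z) ^+ 2)%:E)%E
         (Num.max 0 (r - a * c) *: e).
Proof.
move=> e1 c0 a0 r0 z; rewrite -!EFinM -!EFinD lee_fin.
set s := Num.max 0 _.
have s0 : 0 <= s by rewrite le_max lexx.
rewrite -scalerBl !normZ e1 !mulr1 real_normK ?num_real // (ger0_norm s0).
have := ler_wpM2l r0 (inner_le_norm e z); rewrite e1 mul1r => H.
have -> : norm (r *: e - z) ^+ 2 = r ^+ 2 - 2 * r * inner e z + norm z ^+ 2.
  by rewrite !sqr_norm !innerE (hBsa z e) -!sqr_norm e1; ring.
have := norm_ge0 z; set n := norm z in H *; move=> n0.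
have nH : a * (c * s) + 2^-1 * (r - s) ^+ 2 <= a * (c * n) + 2^-1 * (r - n) ^+ 2.
  rewrite /s; case: (lerP 0 (r - a * c)) => h.
    by have := sqr_ge0 (n - (r - a * c)); lra.
  have : 0 <= n * (a * c - r) by rewrite mulr_ge0 // subr_ge0; lra.
  by have := sqr_ge0 n; lra.
by apply: (le_trans nH); lra.
Qed.

(* On [c * norm], each proximal step moves the iterate towards 0 by
   [alpha k * c], until it stops at 0. *)
Fixpoint radius (alpha : nat -> K) (c R : K) (k : nat) : K :=
  if k is k'.+1 then Num.max 0 (radius alpha c R k' - alpha k * c) else R.

Lemma radius_ge0 alpha c R k : 0 <= R -> 0 <= radius alpha c R k.
Proof. by case: k => //= k _; rewrite le_max lexx. Qed.

(** Truncation at 0 can only increase the radius. *)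
Lemma radius_ge (alpha : nat -> K) (c R : K) k :
  R - c * \sum_(1 <= i < k.+1) alpha i <= radius alpha c R k.
Proof.
elim: k => [|k IH]; first by rewrite big_nil mulr0 subr0.
by rewrite big_nat_recr //= le_max; apply/orP; right; lra.
Qed.

Lemma proximal_lower_bound (alpha : nat -> K) (N : nat) (R : K) :
  (forall k, (1 <= k)%N -> 0 < alpha k) -> (1 <= N)%N -> 0 <= R ->
  (exists e : E, e != 0) ->
  exists (F : E -> \bar K) (xstar : E) (x : nat -> E),
      [/\ [/\ proper_function F, closed_function pair B F & convex_efunction F],
          argmin F xstar,
          norm (x 0%N - xstar) <= R,
          proximal_sequence pair B alpha F x
        & ((R ^+ 2 / (4 * \sum_(1 <= k < N.+1) alpha k))%:E
            <= F (x N) - F xstar)%E].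
Proof.
move=> alpha0 N1 R0 [e0 e0N0].
set S := \sum_(_ <= _ < _) _.
have S0 : 0 < S.
  rewrite /S big_ltn // ltr_wpDr ?alpha0 // big_nat sumr_ge0 // => k /andP[k2 _].
  exact/ltW/alpha0/ltnW.
pose e := (norm e0)^-1 *: e0.
have e1 : norm e = 1.
  rewrite normZ ger0_norm ?invr_ge0 ?norm_ge0 // mulVf // gt_eqF //.
  exact: norm_gt0.
(* This slope maximizes [c * (R - c * S)], with maximum [R ^+ 2 / (4 * S)]. *)
pose c := R / (2 * S).
have c0 : 0 <= c by rewrite divr_ge0 // mulr_ge0 // ltW.
exists (fun z => (c * norm z)%:E), 0, (fun k => radius alpha c R k *: e); split.
- split; first by split => [//|]; exists 0; rewrite ltry.
    exact: scaled_norm_closed.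
  exact: scaled_norm_convex.
- by move=> z; rewrite lee_fin norm0 mulr0 mulr_ge0 ?norm_ge0.
- by rewrite subr0 normZ e1 mulr1 ger0_norm.
- move=> [//|k] _; exact: (proximal_scaled_norm e1 c0 (alpha0 k.+1 isT) (radius_ge0 _ _ _ R0)).
- rewrite norm0 mulr0 sube0 lee_fin normZ e1 mulr1 ger0_norm ?radius_ge0 //.
  apply: le_trans (ler_wpM2l c0 (radius_ge _ _ _ _)); rewrite -/S /c.
  by rewrite le_eqVlt; apply/orP; left; apply/eqP; field; rewrite gt_eqF.
Qed.

End InnerProduct.

Theorem theorem4p1 (K : realType) (E : vectType K)
    (pair : {bilinear dual E -> E -> K | *%R & *%R})
    (B : {linear E -> dual E})
    (hpair : nondegenerate_pairing pair)
    (hBsa : self_adjoint pair B) (hBpd : positive_definite pair B)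
    (alpha : nat -> K) (halpha : forall k, (1 <= k)%N -> 0 < alpha k)
    (N : nat) (hN : (1 <= N)%N) (R : K) (hR : 0 <= R) :
  (forall (F : E -> \bar K) (xstar : E) (x : nat -> E),
      proper_function F -> closed_function pair B F -> convex_efunction F ->
      argmin F xstar ->
      normE pair B (x 0%N - xstar) <= R ->
      proximal_sequence pair B alpha F x ->
      (F (x N) - F xstar <= (R ^+ 2 / (4 * \sum_(1 <= k < N.+1) alpha k))%:E)%E)
  /\
  (\dim (fullv : {vspace E}) = 1%N ->
    ereal_sup [set v | exists (F : E -> \bar K) (xstar : E) (x : nat -> E),
      [/\ [/\ proper_function F, closed_function pair B F & convex_efunction F],
          argmin F xstar,
          normE pair B (x 0%N - xstar) <= R,
          proximal_sequence pair B alpha F x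
        & v = (F (x N) - F xstar)%E]]
    = (R ^+ 2 / (4 * \sum_(1 <= k < N.+1) alpha k))%:E).
Proof.
have upper := proximal_upper_bound hBsa hBpd halpha hN.
split=> [F xstar x Fproper _|dimE]; first exact: upper.
have E_neq0 : exists e : E, e != 0.
  by exists (vpick (fullv : {vspace E})); rewrite vpick0 -dimv_eq0 dimE.
have [F [xs [x [[Fp Fc Fx] Fm x0 xp le]]]] :=
  proximal_lower_bound hBsa hBpd halpha hN hR E_neq0.
(* The upper bound holds for each member of the set, and the scaled norm supplies a member reaching
   it. *)
apply/eqP; rewrite eq_le; apply/andP; split.
  apply: ge_ereal_sup => _ [G [ys [y [[Gp Gc Gx] Gm y0 yp ->]]]].
  exact: (upper _ _ _ _ Gp Gx Gm y0 yp).
by apply: le_trans le _; apply: ereal_sup_ubound; exists F, xs, x.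
Qed.
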